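(* Let $(M,d)$ be a bounded metric space, $X$ a Banach space and $\alpha\geq 0$. Let $\varphi:M\to 2^{X}$ be a closed- and convex-valued lower hemicontinuous correspondence that is lower pointwise $(\alpha+\varepsilon)$-Lipschitz for every $\varepsilon>0$. Then, for any $\beta>\alpha$, there exists a bounded continuous selection of $\varphi$ that is pointwise $\beta$-Lipschitz on a dense set of $M$.
   Context: A correspondence from a set $A$ to a set $B$ is a set-valued map $\varphi:A\to 2^{B}$. It is closed-valued (respectively convex-valued) if $\varphi(a)$ is closed (respectively convex) for all $a\in A$. A selection of $\varphi$ is a function $f:A\to B$ with $f(a)\in\varphi(a)$ for all $a\in A$. If $A,B$ are topological spaces, $\varphi$ is lower hemicontinuous if, for every $a\in A$ and every open $U\subseteq B$ with $\varphi(a)\cap U\neq\emptyset$, there is an open set $V\ni a$ such that $\varphi(v)\cap U\ne\emptyset$ for all $v\in V$. For a metric space $(M,d)$, a normed space $X$ with closed unit ball $\mathbf{B}_X$, and $\gamma\ge 0$, a correspondence $\varphi:M\to 2^X$ is lower pointwise $\gamma$-Lipschitz at $b\in M$ if, for every $y\in\varphi(b)$ and every $a\in M$, the set $\varphi(a)\cap\left(y+\gamma\, d(b,a)\,\mathbf{B}_X\right)$ is non-empty. It is lower pointwise $\gamma$-Lipschitz if this holds at every $b\in M$. A map $f:M\to X$ is pointwise $\beta$-Lipschitz at $b\in M$ if $\limsup_{r\to 0^+}\left(r^{-1}\sup\{\|f(b)-f(a)\| : a\in M,\ d(a,b)\le r\}\right)\le\beta$. It is pointwise $\beta$-Lipschitz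 on a set $S\subseteq M$ if this holds at every point of $S$.
   Formalization: The correspondence is assumed to have non-empty values; this excludes only the everywhere-empty correspondence, which satisfies every other hypothesis vacuously but has no selection when M is non-empty. *)

(* Defs.v *)
From HB Require Import structures.
From mathcomp Require Import all_boot all_order all_algebra.
From mathcomp Require Import all_classical all_reals all_analysis.

Set Implicit Arguments.
Unset Strict Implicit.
Unset Printing Implicit Defensive.

Import Order.TTheory GRing.Theory Num.Theory.
Import numFieldNormedType.Exports.

Local Open Scope classical_set_scope.
Local Open Scope ring_scope.

Definition bounded_metric (R : realType) (M : metricType R) : Prop :=
  exists K : R, forall x y : M, mdist x y <= K.

(* Correspondences are maps [A -> set B], whose values may be empty. *)
Definition nonempty_valued (A B : Type) (phi : A -> set B) : Prop :=
  forall a, phi a !=set0.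

Definition closed_valued (A : Type) (B : topologicalType) (phi : A -> set B)
    : Prop :=
  forall a, closed (phi a).

Definition convex_valued (R : realType) (A : Type) (X : lmodType R)
    (phi : A -> set X) : Prop :=
  forall a, convex_set (phi a : set (convex_lmodType X)).

Definition selection (A B : Type) (phi : A -> set B) (f : A -> B) : Prop :=
  forall a, phi a (f a).

Definition lower_hemicontinuous (A B : topologicalType) (phi : A -> set B)
    : Prop :=
  forall (a : A) (U : set B), open U -> phi a `&` U !=set0 ->
    exists V : set A,
      [/\ open V, V a & forall v, V v -> phi v `&` U !=set0].

Definition unit_ball (R : realType) (X : normedModType R) : set X :=
  [set u | `|u| <= 1].

Definition lower_pointwise_lipschitz_at (R : realType) (M : metricType R)
    (X : normedModType R) (gamma : R) (phi : M -> set X) (b : M) : Prop :=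
  forall y, phi b y -> forall a : M,
    phi a `&` [set y + (gamma * mdist b a) *: u | u in @unit_ball R X] !=set0.

Definition lower_pointwise_lipschitz (R : realType) (M : metricType R)
    (X : normedModType R) (gamma : R) (phi : M -> set X) : Prop :=
  forall b, lower_pointwise_lipschitz_at gamma phi b.

(* Supremum and limsup are taken in the extended reals, so that they exist for
   every [f]. *)
Definition pointwise_lipschitz_at (R : realType) (M : metricType R)
    (X : normedModType R) (beta : R) (f : M -> X) (b : M) : Prop :=
  (limf_esup (fun r : R =>
     (r^-1)%:E * ereal_sup [set `|f b - f a|%:E | a in [set a | (mdist a b <= r)%R]])
   0^'+ <= beta%:E)%E.

Definition pointwise_lipschitz_on (R : realType) (M : metricType R)
    (X : normedModType R) (beta : R) (f : M -> X) (S : set M) : Prop :=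
  forall b, S b -> pointwise_lipschitz_at beta f b.

(* Main.v *)
Require Import Defs.
From HB Require Import structures.
From mathcomp Require Import all_boot all_order all_algebra.
From mathcomp Require Import all_classical all_reals all_analysis.
From mathcomp Require Import wochoice ring lra.

Set Implicit Arguments.
Unset Strict Implicit.
Unset Printing Implicit Defensive.

Import Order.TTheory GRing.Theory Num.Theory.
Import numFieldNormedType.Exports.

Local Open Scope classical_set_scope.
Local Open Scope ring_scope.

(* A continuous selection f can be corrected near the points b of a separated
   set N so that it stays in the cone |f a - f b| <= gamma d(a, b) around each
   of them, without changing it at b: apply Michael's selection theorem to the
   correspondence cut down by these cones and by a small ball around f.
   Doing this successively for maximal 2^-n-separated sets, with the n-th
   correction bounded by a weight which vanishes at the points already treated
   and is at most a small multiple of the distance to them, gives a uniformly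
   convergent sequence; the limit keeps its cones, up to a slightly larger
   slope, at every point ever treated, and these points are dense.

   Michael's theorem needs locally finite partitions of unity on M. For an open
   cover indexed by a well-ordered set, let f_i be the distance to the
   complement of U_i, h_i = f_i - sup_(j < i) f_j and H = sup_i h_i > 0; then
   the functions max(0, h_i - H / 2) form such a partition, up to
   normalization. *)

(** * Lipschitz functions and the truncated distance to a set *)

Section Lipschitz.
Context {R : realType} {M : metricType R}.
Implicit Types (L : R) (x y : M).

Lemma near_mdistP x (P : set M) :
  (\forall y \near x, P y) <->
  exists2 r : R, 0 < r & forall y, mdist x y < r -> P y.
Proof.
split=> [/nbhs_ballP[r r0 xP]|[r r0 xP]].
  by exists r => // y xy; apply: xP; rewrite ballEmdist.
by apply/nbhs_ballP; exists r => // y; rewrite ballEmdist => /xP.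
Qed.

Lemma near_mdist_lt x (r : R) : 0 < r -> \forall y \near x, mdist x y < r.
Proof. by move=> r0; apply/near_mdistP; exists r. Qed.

(** Exchanging [x] and [y] gives the other inequality, so one side is enough. *)
Definition lip L (F : M -> R) := forall x y, F x <= F y + L * mdist x y.

Lemma lip_continuous L (F : M -> R) : lip L F -> continuous F.
Proof.
move=> LF x; apply/cvgrPdist_lt => e e0.
have K0 : 0 < `|L| + 1 by rewrite ltr_wpDl.
near=> y.
have xy : mdist x y < e / (`|L| + 1).
  by near: y; apply: near_mdist_lt; rewrite divr_gt0.
rewrite ltr_pdivlMr// in xy.
have d0 := mdist_ge0 x y.
have Ld : L * mdist x y <= `|L| * mdist x y by rewrite ler_wpM2r// ler_norm.
have := LF x y; have := LF y x; rewrite (metric_sym y x).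
by rewrite ltr_norml => ? ?; apply/andP; split; lra.
Unshelve. all: by end_near. Qed.

Lemma mdist_lip x : lip 1 (mdist x).
Proof.
move=> y z; rewrite mul1r (metric_sym y z); exact: metric_triangle.
Qed.

(** Adjoining 0 gives the supremum over an empty [P] the value 0. *)
Definition sup0 {I} (P : set I) (F : I -> M -> R) x : R :=
  sup (0 |` [set F i x | i in P]).

Section sup0.
Context {I : Type} (P : set I) (F : I -> M -> R).
Hypothesis F1 : forall i x, F i x <= 1.

Let has_sup0 x : has_sup (0 |` [set F i x | i in P]).
Proof.
split; first by exists 0; left.
by exists 1 => _ [->|[i _ <-]].
Qed.

Lemma sup0_ge0 x : 0 <= sup0 P F x.
Proof. by apply: sup_upper_bound => //; left. Qed.

Lemma sup0_ub x i : P i -> F i x <= sup0 P F x.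
Proof. by move=> Pi; apply: sup_upper_bound => //; right; exists i. Qed.

Lemma sup0_le x c : 0 <= c -> (forall i, P i -> F i x <= c) -> sup0 P F x <= c.
Proof.
move=> c0 Fc; apply: ge_sup; first by exists 0; left.
by move=> _ [->//|[i Pi <-]]; exact: Fc.
Qed.

Lemma sup0_gt x c : 0 <= c -> c < sup0 P F x -> exists2 i, P i & c < F i x.
Proof.
move=> c0 /sup_gt[|y [->|[i Pi <-]] cy]; first by exists 0; left.
  by move: cy; rewrite ltNge c0.
by exists i.
Qed.

Lemma sup0_lip L : 0 <= L -> (forall i, P i -> lip L (F i)) -> lip L (sup0 P F).
Proof.
move=> L0 LF x y; apply: sup0_le => [|i Pi].
  by rewrite addr_ge0 ?sup0_ge0// mulr_ge0// mdist_ge0.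
by apply: (le_trans (LF i Pi x y)); rewrite lerD2r sup0_ub.
Qed.

End sup0.

(* The distance to N, truncated at 1 so that it makes sense for empty N. *)
Definition tdist (N : set M) x : R := 1 - sup0 N (fun b a => 1 - mdist b a) x.

Let tdist1 (b a : M) : 1 - mdist b a <= 1.
Proof. by rewrite gerBl mdist_ge0. Qed.

Lemma tdist_le1 N x : tdist N x <= 1.
Proof. by rewrite /tdist gerBl sup0_ge0. Qed.

Lemma tdist_ge0 N x : 0 <= tdist N x.
Proof. by rewrite /tdist subr_ge0 sup0_le. Qed.

Lemma tdist_le N x b : N b -> tdist N x <= mdist b x.
Proof. by move=> Nb; rewrite /tdist lerBlDr -lerBlDl (@sup0_ub _ N _ tdist1). Qed.

Lemma tdist_ge N x (r : R) : r <= 1 -> (forall b, N b -> r <= mdist b x) -> r <= tdist N x.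
Proof.
move=> r1 rN; rewrite /tdist lerBrDl -lerBrDr sup0_le// ?subr_ge0// => b Nb.
by rewrite lerD2l lerN2 rN.
Qed.

Lemma tdist_lip N : lip 1 (tdist N).
Proof.
have S : lip 1 (sup0 N (fun b a => 1 - mdist b a)).
  apply: sup0_lip => // b Nb x y.
  by have := mdist_lip b y x; rewrite (metric_sym y x); lra.
by move=> x y; have := S y x; rewrite /tdist (metric_sym y x); lra.
Qed.

End Lipschitz.

(** * Partitions of unity subordinate to an open cover *)

Section PartitionOfUnity.
Context {R : realType} {M : metricType R} {I : eqType} (U : I -> set M).
Hypothesis U_open : forall i, open (U i).
Hypothesis U_cover : forall x, exists i, U i x.

Variable R0 : rel I.
Hypothesis R0_wo : well_order R0.

Let before i : set I := [set j | R0 j i && (j != i)].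

Let R0_min (A : pred I) i : A i -> exists2 k, A k & forall j, A j -> R0 k j.
Proof.
by move=> Ai; have [|k [[Ak Amin] _]] := R0_wo (A := A); [exists i|exists k].
Qed.

Let R0_anti i j : R0 i j -> R0 j i -> i = j.
Proof.
move=> ij ji; apply: (@wo_chain_antisymmetric _ R0 predT) => //.
  by move=> A _; exact: R0_wo.
by rewrite ij ji.
Qed.

Let before_total i j : i != j -> before i j \/ before j i.
Proof.
move=> ij; rewrite /before/= ij eq_sym ij !andbT; apply/orP; rewrite orbC.
by apply: (@wo_chainW _ R0 predT) => // A _; exact: R0_wo.
Qed.

Let f i : M -> R := tdist (~` U i).
Let h i x : R := f i x - sup0 (before i) f x.
Let H x : R := sup0 setT h x.
Let w i x : R := Num.max 0 (h i x - H x / 2).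

Let f1 i x : f i x <= 1. Proof. exact: tdist_le1. Qed.

Let h_le_f i x : h i x <= f i x.
Proof. by rewrite gerBl sup0_ge0. Qed.

Let h1 i x : h i x <= 1. Proof. exact: le_trans (h_le_f i x) (f1 i x). Qed.

Let h_lip i : lip 2 (h i).
Proof.
have S : lip 1 (sup0 (before i) f) by apply: sup0_lip => // j _; exact: tdist_lip.
move=> x y; have := S y x; have := tdist_lip (~` U i) x y.
by rewrite (metric_sym y x) /h /f; lra.
Qed.

Let H_lip : lip 2 H.
Proof. by apply: sup0_lip. Qed.

Let w_lip i : lip 3 (w i).
Proof.
move=> x y; have := h_lip i x y; have := H_lip y x.
have := mdist_ge0 x y; rewrite (metric_sym y x) /w => d0 Hyx hxy.
rewrite ge_max; apply/andP; split.
  by rewrite addr_ge0 ?le_max ?lexx// mulr_ge0.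
have : h i y - H y / 2 <= Num.max 0 (h i y - H y / 2) by rewrite le_max lexx orbT.
lra.
Qed.

Let f_gt0P i x : 0 < f i x <-> U i x.
Proof.
split=> [fi|Ui].
  apply: contrapT => nUi; move: fi; rewrite ltNge => /negP; apply.
  by rewrite -(mdistxx x); exact: (@tdist_le _ _ (~` U i)).

have /near_mdistP[r r0 rU] : \forall y \near x, U i y by exact: open_nbhs_nbhs.
apply: (@lt_le_trans _ _ (Num.min 1 r)); first by rewrite lt_min ltr01.
apply: tdist_ge => [|b nUb]; first by rewrite ge_min lexx.
rewrite ge_min; apply/orP; right; rewrite leNgt; apply/negP.
by rewrite metric_sym => /rU.
Qed.

(** At the least [k] with [x] in [U k], all earlier [f j x] vanish, so [h k x = f k x > 0]. *)
Let H_gt0 x : 0 < H x.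
Proof.
have [i Ui] := U_cover x.
have [|k /asboolP Uk kmin] := R0_min (A := fun j => `[< U j x >]) (i := i).
  exact/asboolP.
apply: (@lt_le_trans _ _ (h k x)); last exact: sup0_ub.
rewrite subr_gt0; apply: (@le_lt_trans _ _ 0); last exact/f_gt0P.
apply: sup0_le => // j /andP[jk njk]; rewrite leNgt; apply/negP => /f_gt0P Uj.
move/eqP: njk; apply; apply: R0_anti jk _.
by apply: kmin; exact/asboolP.
Qed.

(* Along the well-order, each index with h > t beats all the previous values
   of f by more than t; since f <= 1 there are at most 1 / t of them. *)
Let finite_records (t : R) x : 0 < t -> finite_set [set i | t < h i x].
Proof.
(* Rounding [f i x / t] down turns a jump of [f] by more than [t] into a strict increase of [g], so
   [g] is injective on the records. *)
move=> t0; pose g i := Num.truncn (f i x / t).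
have ft0 i : 0 <= f i x / t by rewrite divr_ge0 ?tdist_ge0// ltW.
have gbefore i j : t < h j x -> before j i -> (g i < g j)%N.
  move=> hj ij; rewrite /g truncn_lt_nat//.
  have /andP[_ gj] := truncn_itv (ft0 j).
  have : f i x / t + 1 < f j x / t.
    rewrite -(@divff _ t) ?lt0r_neq0// -mulrDl ltr_pM2r ?invr_gt0//.
    by have := @sup0_ub _ _ _ _ f f1 x i ij; move: hj; rewrite /h; lra.
  by rewrite -natr1 in gj; lra.
have ginj : {in [set i | t < h i x] &, injective g}.
  move=> i j; rewrite !inE => /= hi hj gij; apply/eqP/negPn/negP => /before_total.
  by move=> [/(gbefore _ _ hi)|/(gbefore _ _ hj)]; rewrite gij ltnn.
rewrite -(eq_finite_set (inj_card_eq ginj)).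
apply: (@sub_finite_set _ _ `I_(Num.truncn t^-1).+1) => // _ [i _ <-] /=.
rewrite ltnS le_truncn// -[leRHS]mul1r ler_pM2r ?invr_gt0//.
Qed.

Lemma partition_wo : exists w : I -> M -> R,
  [/\ forall i, continuous (w i), forall i x, 0 <= w i x,
      forall i x, 0 < w i x -> U i x, forall x, exists i, 0 < w i x &
      forall x : M, exists2 s : seq I, uniq s &
        \forall y \near x, forall i, i \notin s -> w i y = 0].
Proof.
exists w; split.
- by move=> i; exact: lip_continuous (w_lip i).
- by move=> i x; rewrite le_max lexx.
- move=> i x; rewrite lt_max ltxx/= subr_gt0 => Hh; apply/f_gt0P.
  apply: lt_le_trans (h_le_f i x); apply: lt_trans Hh.
  by rewrite divr_gt0.
- move=> x; have H0 := H_gt0 x.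
  have : H x / 2 < H x by lra.
  case/sup0_gt => [|i _ Hh]; first by rewrite divr_ge0 // ltW.
  by exists i; rewrite lt_max subr_gt0 Hh orbT.
- move=> x; have H0 := H_gt0 x.
  (* If [mdist x y < H x / 12], then [H y > 5/6 H x], so [w i y > 0] forces
     [h i x > 5/12 H x - 1/6 H x = H x / 4]. *)
  have /finite_seqP[s sE] : finite_set [set i | H x / 4 < h i x].
    by apply: finite_records; rewrite divr_gt0.
  exists (undup s); first exact: undup_uniq.
  near=> y => i; rewrite mem_undup => /negP si.
  apply/eqP; rewrite eq_le le_max lexx andbT ge_max lexx/= subr_le0.
  rewrite leNgt; apply/negP => Hh; apply: si.
  suff : [set` s] i by []. rewrite -sE /=.
  have xy : mdist x y < H x / 12.
    by near: y; apply: near_mdist_lt; rewrite divr_gt0.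
  have := h_lip i y x; have := H_lip x y; rewrite (metric_sym y x); lra.
Unshelve. all: by end_near. Qed.

End PartitionOfUnity.

Lemma metric_partition {R : realType} {M : metricType R} {I : eqType}
    (U : I -> set M) :
  (forall i, open (U i)) -> (forall x, exists i, U i x) ->
  exists w : I -> M -> R,
  [/\ forall i, continuous (w i), forall i x, 0 <= w i x,
      forall i x, 0 < w i x -> U i x, forall x, exists i, 0 < w i x &
      forall x : M, exists2 s : seq I, uniq s &
        \forall y \near x, forall i, i \notin s -> w i y = 0].
Proof.
by move=> oU cU; have [R0 wo] := well_ordering_principle I; exact: partition_wo wo.
Qed.

(** * Convex sets in a normed space *)

Section Convexity.
Context {R : realType} {X : normedModType R}.

Definition convex (A : set X) := forall (x y : X) (t : R),
  A x -> A y -> 0 <= t -> t <= 1 -> A (t *: x + (1 - t) *: y).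

Lemma convex_ball (x : X) (r : R) : convex [set y | `|x - y| < r].
Proof.
move=> y z t /= xy xz t0 t1.
have -> : x - (t *: y + (1 - t) *: z) = t *: (x - y) + (1 - t) *: (x - z).
  by rewrite !scalerBr addrACA -opprD -scalerDl (addrC t) subrK scale1r.
rewrite (le_lt_trans (ler_normD _ _))// !normrZ (ger0_norm t0) ger0_norm ?subr_ge0//.
(* Strictness comes from [z] when [t = 0], and from [y] otherwise. *)
have [->|t0'] := eqVneq t 0; first by rewrite mul0r add0r subr0 mul1r.
have : t * `|x - y| < t * r by rewrite ltr_pM2l// lt_def t0' t0.
have : (1 - t) * `|x - z| <= (1 - t) * r by rewrite ler_wpM2l ?subr_ge0// ltW.
lra.
Qed.

Lemma convexI (A B : set X) : convex A -> convex B -> convex (A `&` B).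
Proof. by move=> cA cB x y t [? ?] [? ?] ? ?; split; [exact: cA|exact: cB]. Qed.

Lemma convex_neighbourhood (A : set X) (r : R) : convex A ->
  convex [set v | exists2 y, A y & `|v - y| < r].
Proof.
move=> cA u v t [y Ay uy] [z Az vz] t0 t1.
exists (t *: y + (1 - t) *: z); first exact: cA.
rewrite opprD addrACA -!scalerBr.
have := @convex_ball 0 r (u - y) (v - z) t; rewrite /= !sub0r !normrN.
by apply.
Qed.

Lemma convex_sum (I : Type) (A : set X) (s : seq I) (w : I -> R) (z : I -> X) :
  convex A -> (forall i, 0 <= w i) -> (forall i, 0 < w i -> A (z i)) ->
  0 < \sum_(i <- s) w i ->
  A ((\sum_(i <- s) w i)^-1 *: \sum_(i <- s) w i *: z i).
Proof.
move=> cA w0 Az.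
(* The average is meaningless while all weights met so far are zero, so the induction carries that
   case as an alternative. *)
suff [[-> _]|[_ //]] : (\sum_(i <- s) w i = 0 /\ \sum_(i <- s) w i *: z i = 0) \/
    (0 < \sum_(i <- s) w i /\
     A ((\sum_(i <- s) w i)^-1 *: \sum_(i <- s) w i *: z i)).
  by rewrite ltxx.
elim: s => [|i s IH]; first by rewrite !big_nil; left.
rewrite !big_cons; have [->|wi0] := eqVneq (w i) 0.
  by rewrite scale0r !add0r.
have {}wi0 : 0 < w i by rewrite lt_def wi0 w0.
right; case: IH => [[-> ->]|[S0 AS]].
  by rewrite !addr0 scalerA mulVf ?lt0r_neq0// scale1r; split => //; exact: Az.
set S := \sum_(j <- s) w j in S0 AS *.
set V := \sum_(j <- s) w j *: z j in AS *.
have wS0 : 0 < w i + S by rewrite addr_gt0.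
split => //.
have -> : (w i + S)^-1 *: (w i *: z i + V) =
    (w i / (w i + S)) *: z i + (1 - w i / (w i + S)) *: (S^-1 *: V).
  rewrite scalerDr !scalerA; congr (_ *: _ + _ *: _); field.
    by rewrite lt0r_neq0.
  by rewrite !lt0r_neq0.
apply: cA => //; first exact: Az.
- by rewrite divr_ge0// ltW.
- by rewrite ler_pdivrMr// mul1r lerDl ltW.
Qed.

End Convexity.

(** * Approximate continuous selections *)

Section Selection.
Context {R : realType} {M : metricType R} {X : completeNormedModType R}.
Implicit Types (phi : M -> set X) (f : M -> X).

(** Lower hemicontinuity in metric form, tested on balls around points of the value. *)
Definition lhc phi := forall a y (e : R), phi a y -> 0 < e ->
  \forall b \near a, exists2 z, phi b z & `|y - z| < e.

Lemma continuous_sum_seq (T : topologicalType) (V : normedModType R)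
    (I : Type) (s : seq I) (F : I -> T -> V) :
  (forall i, continuous (F i)) -> continuous (fun a => \sum_(i <- s) F i a).
Proof.
move=> Fc a; elim: s => [|i s IH].
  by under eq_fun do rewrite big_nil; exact: cvg_cst.
under eq_fun do rewrite big_cons.
by apply: cvgD => //; exact: Fc.
Qed.

(** Average the points [y] of [X] against a partition subordinate to the sets of [a] where [phi a]
    comes within [e] of [y]. The [y] of positive weight at [a] lie in the [e]-neighbourhood of
    [phi a], which is convex. *)
Lemma approximate_selection phi (e : R) : 0 < e -> lhc phi ->
  (forall a, convex (phi a)) -> (forall a, phi a !=set0) ->
  exists f, continuous f /\ forall a, exists2 y, phi a y & `|f a - y| < e.
Proof.
move=> e0 lphi cphi nphi.
pose U (y : X) := [set a | exists2 z, phi a z & `|y - z| < e].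
have Uo y : open (U y).
  rewrite openE => a [z az yz].
  have : 0 < e - `|y - z| by rewrite subr_gt0.
  move=> /(lphi _ _ _ az); apply: filterS => b [z' bz' zz'].
  exists z' => //; have := ler_distD z y z'; lra.
have Uc a : exists y, U y a.
  by have [y ay] := nphi a; exists y, y => //; rewrite subrr normr0.
have [w [wc w0 wU wex wfin]] := metric_partition Uo Uc.
(* Near each point these sums over all of [X] reduce to one fixed finite sequence, which gives
   continuity. *)
pose S a : R := \sum_(y \in [set: X]) w y a.
pose V a : X := \sum_(y \in [set: X]) w y a *: y.
have SE s a : uniq s -> (forall y, y \notin s -> w y a = 0) ->
    S a = \sum_(y <- s) w y a.
  move=> us ws; rewrite /S (fsbigE s)//=; last by move=> y _; exact: ws.
  by apply: eq_bigl => y; rewrite in_setT.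
have VE s a : uniq s -> (forall y, y \notin s -> w y a = 0) ->
    V a = \sum_(y <- s) w y a *: y.
  move=> us ws; rewrite /V (fsbigE s)//=; last by move=> y _ /ws ->; rewrite scale0r.
  by apply: eq_bigl => y; rewrite in_setT.
have S0 a : 0 < S a.
  have [s us /nbhs_singleton ws] := wfin a; rewrite (SE s)//.
  have [y wy] := wex a; have ys : y \in s.
    by apply/negPn/negP => /ws wy0; rewrite wy0 ltxx in wy.
  rewrite (big_rem y)//= ltr_pwDl// sumr_ge0// => i _; exact: w0.
exists (fun a => (S a)^-1 *: V a); split=> a; last first.
  have [s us /nbhs_singleton ws] := wfin a; rewrite (SE s)// (VE s)//.
  have := S0 a; rewrite (SE s)// => Sa.
  apply: (@convex_sum _ _ _ [set v | exists2 y, phi a y & `|v - y| < e]) => //.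
    exact: convex_neighbourhood.
  by move=> y /wU.
have [s us ws] := wfin a.
apply: cvgZ.
  apply: cvgV; first by rewrite lt0r_neq0.
  have SEn : \forall b \near a, \sum_(y <- s) w y b = S b.
    by apply: filterS ws => b wb; rewrite (SE s).
  apply: cvg_trans (near_eq_cvg SEn) _.
  rewrite (SE s) //; last exact: nbhs_singleton ws.
  exact: continuous_sum_seq.
have VEn : \forall b \near a, \sum_(y <- s) w y b *: y = V b.
  by apply: filterS ws => b wb; rewrite (VE s).
apply: cvg_trans (near_eq_cvg VEn) _.
rewrite (VE s) //; last exact: nbhs_singleton ws.
by apply: continuous_sum_seq => y b; apply: cvgZr_tmp; exact: wc.
Qed.

End Selection.

(** * Dependent choice and geometric convergence *)

Section UniformLimits.
Context {R : realType}.
Local Notation q := (2^-1 : R).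

Lemma dependent_sequence (T : Type) (good : nat -> T -> Prop)
    (rel : nat -> T -> T -> Prop) :
  (exists x, good 0 x) ->
  (forall n x, good n x -> exists2 y, good n.+1 y & rel n x y) ->
  exists u : nat -> T, forall n, good n (u n) /\ rel n (u n) (u n.+1).
Proof.
move=> [x0 x0P] step.
have /choice[s sP] : forall p : nat * T, exists y,
    good p.1 p.2 -> good p.1.+1 y /\ rel p.1 p.2 y.
  move=> [n x]; have [nx|nx] := pselect (good n x); last by exists x.
  by have [y ? ?] := step n x nx; exists y.
pose fix u n := if n is m.+1 then s (m, u m) else x0.
have ug n : good n (u n) by elim: n => //= n /(sP (n, _))[].
by exists u => n; split=> //; have [] := sP (n, u n) (ug n).
Qed.

Lemma half_expr_lt (K e : R) : 0 < e -> exists n, K * q ^+ n < e.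
Proof.
move=> e0; pose n := (Num.truncn (`|K| / e)).+1; exists n.
rewrite exprVn ltr_pdivrMr ?exprn_gt0//.
have Kn : `|K| < n%:R * e by rewrite -ltr_pdivrMr// /n truncnS_gt.
apply: (le_lt_trans (ler_norm K)); apply: (lt_le_trans Kn).
by rewrite mulrC ler_pM2l// -natrX ler_nat ltnW// ltn_expl.
Qed.

Section Limit.
Context {X : completeNormedModType R}.

Lemma geometric_cauchy_lim (u : nat -> X) (K : R) :
  (forall n, `|u n.+1 - u n| <= K * q ^+ n) ->
  exists l, forall n, `|l - u n| <= 2 * K * q ^+ n.
Proof.
move=> uK.
have K0 : 0 <= K by have := uK 0%N; rewrite expr0 mulr1; exact: le_trans.
have tail n k : `|u (n + k)%N - u n| <= 2 * K * q ^+ n.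
  (* The subtracted term makes the induction exact: adding [K * q ^+ (n + k)] turns the bound for
     [k] into the one for [k.+1]. *)
  suff : `|u (n + k)%N - u n| <= 2 * K * (q ^+ n - q ^+ (n + k)).
    move=> /le_trans; apply; rewrite ler_wpM2l ?mulr_ge0// gerBl.
    by rewrite exprn_ge0// invr_ge0.
  elim: k => [|k IH]; first by rewrite addn0 !subrr normr0 mulr0.
  have := ler_distD (u (n + k)%N) (u (n + k.+1)%N) (u n).
  have := uK (n + k)%N; rewrite addnS exprS; lra.
have ucvg : cvg (u @ \oo).
  apply: cauchy_cvg; apply: cauchy_exP => e /= e0.
  have [n ne] := half_expr_lt (2 * K) e0.
  exists (u n); exists n => // m /= nm.
  rewrite -ball_normE /= distrC (le_lt_trans _ ne)//.
  by rewrite -(subnKC nm).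
exists (lim (u @ \oo)) => n; apply/ler_addgt0Pr => e e0.
have /cvgrPdist_lt/(_ e e0)[N _ NP] := ucvg.
have := NP (n + N)%N (leq_addl _ _); have := tail n N.
have := ler_distD (u (n + N)%N) (lim (u @ \oo)) (u n).
lra.
Qed.

Lemma geometric_lim_continuous (T : topologicalType) (f : nat -> T -> X)
    (g : T -> X) (K : R) :
  (forall n, continuous (f n)) ->
  (forall n a, `|g a - f n a| <= K * q ^+ n) -> continuous g.
Proof.
move=> fc gf a; apply/cvgrPdist_lt => e e0.
have e3 : 0 < e / 3 by rewrite divr_gt0.
have [n ne] := half_expr_lt K e3.
have /cvgrPdist_lt/(_ _ e3) := fc n a.
apply: filterS => b fab.
have := gf n a; have := gf n b.
have := ler_distD (f n a) (g a) (g b).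
have := ler_distD (f n b) (f n a) (g b).
rewrite (distrC (f n b) (g b)); lra.
Qed.

End Limit.
End UniformLimits.

(** * Michael's selection theorem *)

Section Michael.
Context {R : realType} {M : metricType R} {X : completeNormedModType R}.
Implicit Types (phi : M -> set X) (f : M -> X).

(** The ball is open, so [y] leaves a slack [3 * d], shared among the moves from [y] to [z], from
    [f a] to [f b] and from [r a] to [r b]. *)
Lemma lhcI_ball phi f (r : M -> R) : lhc phi -> continuous f -> continuous r ->
  lhc (fun a => phi a `&` [set y | `|f a - y| < r a]).
Proof.
move=> lphi fc rc a y e [ay fy] e0.
have d0 : 0 < (r a - `|f a - y|) / 3 by rewrite divr_gt0// subr_gt0.
set d := _ / 3 in d0.
have dE : r a = `|f a - y| + 3 * d by rewrite /d; field.
near=> b.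
have [z bz yz] : exists2 z, phi b z & `|y - z| < Num.min e d.
  by near: b; apply: lphi => //; rewrite lt_min e0.
move: yz; rewrite lt_min => /andP[yze yzd].
exists z => //; split => //=.
have fab : `|f a - f b| < d by near: b; move/cvgrPdist_lt : (fc a); exact.
have : `|r a - r b| < d by near: b; move/cvgrPdist_lt : (rc a); exact.
rewrite ltr_norml => /andP[_ rab].
have := ler_distD (f a) (f b) z; have := ler_distD y (f a) z.
rewrite (distrC (f b) (f a)); lra.
Unshelve. all: by end_near. Qed.

(** Each approximate selection is taken from [phi] cut by a ball around the previous one, so the
    sequence converges uniformly. The limit lies in the closure of [phi a]; closedness is left to
    the caller, so that [phi] may be cut by open conditions. *)
Lemma michael_selection phi : lhc phi -> (forall a, convex (phi a)) ->
  (forall a, phi a !=set0) ->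
  exists f, continuous f /\
    forall a (e : R), 0 < e -> exists2 y, phi a y & `|f a - y| < e.
Proof.
move=> lphi cphi nphi.
pose good n f := continuous f /\
  forall a, exists2 y, phi a y & `|f a - y| < 2^-1 ^+ n.
pose close n f g := forall a : M, `|g a - f a : X| <= 2 * 2^-1 ^+ n :> R.
have q0 n : 0 < 2^-1 ^+ n :> R by rewrite exprn_gt0// invr_gt0.
have [||F FP] := @dependent_sequence _ good close.
- exact: approximate_selection.
- move=> n f [fc fphi].
  have [||||g [gc gphi]] := @approximate_selection R M X
    (fun a => phi a `&` [set y | `|f a - y| < 2^-1 ^+ n]) (2^-1 ^+ n.+1).
  + exact: q0.
  + by apply: lhcI_ball => // a; exact: cvg_cst.
  + by move=> a; apply: convexI => //; exact: convex_ball.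
  + by move=> a; have [y ? ?] := fphi a; exists y.
  exists g; first by split=> // a; have [y [? _] ?] := gphi a; exists y.
  move=> a; have [y [_ /= fy] gy] := gphi a.
  have := ler_distD y (g a) (f a); rewrite (distrC y (f a)).
  by move: gy; rewrite exprS; have := q0 n; lra.
have /choice[f fP] : forall a, exists l, forall n,
    `|l - F n a| <= 2 * 2 * 2^-1 ^+ n.
  by move=> a; apply: (geometric_cauchy_lim (u := F^~ a)) => n; have [_] := FP n.
exists f; split.
  apply: (geometric_lim_continuous (f := F) (K := 2 * 2)) => // n.
  by have [[]] := FP n.
(* The 5 is 4 for the distance from [f] to [F n] plus 1 for that from [F n] to [phi]. *)
move=> a e e0; have [n ne] := half_expr_lt 5 e0.
have [[_ /(_ a)[y ay Fy]] _] := FP n.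
exists y => //; have := ler_distD (F n a) (f a) y; have := fP a n; lra.
Qed.

End Michael.

(** * One correction of a selection by cones *)

Section ConeStep.
Context {R : realType} {M : metricType R} {X : completeNormedModType R}.
Variables (phi : M -> set X).
Hypothesis phi_lhc : lhc phi.
Hypothesis phi_convex : forall a, convex (phi a).
Hypothesis phi_closed : forall a, closed (phi a).

Lemma closed_approx (A : set X) (x : X) : closed A ->
  (forall e : R, 0 < e -> exists2 y, A y & `|x - y| < e) -> A x.
Proof.
move=> cA Ax; apply: cA => B /nbhs_ballP[e /= e0 eB].
by have [y Ay xy] := Ax e e0; exists y; split => //; apply: eB; rewrite -ball_normE.
Qed.

Variable gam : R.
Hypothesis gam_gt0 : 0 < gam.
Hypothesis phi_cone : forall (b : M) y, phi b y -> forall a, a != b ->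
  exists2 z, phi a z & `|y - z| < gam * mdist b a.

Variables (f : M -> X) (eta : M -> R) (N : set M) (del : R).
Hypothesis f_cont : continuous f.
Hypothesis f_sel : forall a, phi a (f a).
Hypothesis eta_cont : continuous eta.
Hypothesis eta_ge0 : forall a, 0 <= eta a.
Hypothesis del_gt0 : 0 < del.
Hypothesis N_sep : forall b c, N b -> N c -> mdist b c < del -> b = c.
Hypothesis N_eta : forall b, N b -> 0 < eta b.

(** Within this radius, everything in the cone over [b] is closer than [eta a] to [f a], so the two
    cuts are compatible. The bound [del / 4] keeps the cones apart. *)
Let cone_radius (b : M) : exists rho : R, N b ->
  [/\ 0 < rho, rho <= del / 4 &
      forall a, mdist b a <= rho -> gam * mdist b a + `|f b - f a| < eta a].
Proof.
have [Nb|nNb] := pselect (N b); last by exists 1.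
have e0 : 0 < eta b / 3 by rewrite divr_gt0// N_eta.
have /near_mdistP[r r0 rP] : \forall a \near b,
    gam * mdist b a + `|f b - f a| < eta a.
  near=> a.
  have fba : `|f b - f a| < eta b / 3.
    by near: a; move/cvgrPdist_lt : (@f_cont b); exact.
  have : `|eta b - eta a| < eta b / 3.
    by near: a; move/cvgrPdist_lt : (@eta_cont b); exact.
  have : mdist b a < eta b / 3 / gam.
    by near: a; apply: near_mdist_lt; rewrite divr_gt0.
  rewrite ltr_pdivlMr// ltr_norml => dba /andP[_]; lra.
(* Halving [r] passes from an open to a closed ball. *)
exists (Num.min (r / 2) (del / 4)) => _; split.
- by rewrite lt_min !divr_gt0.
- by rewrite ge_min lexx orbT.
- move=> a; rewrite le_min => /andP[bar _]; apply: rP; lra.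
Unshelve. all: by end_near. Qed.

Let rho := projT1 (choice cone_radius).
Let rhoP (b : M) : N b -> [/\ 0 < rho b, rho b <= del / 4 &
  forall a, mdist b a <= rho b -> gam * mdist b a + `|f b - f a| < eta a].
Proof. exact: (projT2 (choice cone_radius)). Qed.

Let pinned a := eta a = 0 \/ N a.

Let cone a : set X := [set y | forall b, N b -> mdist b a <= rho b ->
  `|f b - y| < gam * mdist b a].

(** The correspondence given to Michael's theorem. Pinned points keep the value [f a]; elsewhere all
    cuts are strict, hence open. *)
Let psi a : set X := [set y | (pinned a /\ y = f a) \/
  [/\ ~ pinned a, phi a y, `|f a - y| < eta a & cone a y]].

Let psi_phi a y : psi a y -> phi a y.
Proof. by case=> [[_ ->]|[]]. Qed.

Let psi_eta a y : psi a y -> `|f a - y| <= eta a.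
Proof. by case=> [[_ ->]|[_ _ /ltW]] //; rewrite subrr normr0. Qed.

Let psi_cone a b y : psi a y -> N b -> mdist b a <= rho b ->
  `|f b - y| <= gam * mdist b a.
Proof.
move=> ay Nb ba; have [rho0 rhod rhoe] := rhoP Nb.
case: ay => [[pa ->]|[_ _ _ /(_ b Nb ba)/ltW//]].
(* A zero of [eta] cannot lie in the ball of a cone, since [rhoe] would make a non-negative sum
   negative. *)
case: pa => [ea|Na].
  have := rhoe a ba; rewrite ea => lt0.
  have : 0 <= gam * mdist b a + `|f b - f a| by rewrite addr_ge0// mulr_ge0 ?mdist_ge0// ltW.
  by rewrite leNgt lt0.
have <- : b = a by apply: N_sep => //; lra.
by rewrite subrr normr0 mdistxx mulr0.
Qed.

Let psi_convex a : convex (psi a).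
Proof.
move=> x y t ax ay t0 t1; have [pa|npa] := pselect (pinned a).
  left; split => //; case: ax => [[_ ->]|[]//]; case: ay => [[_ ->]|[]//].
  by rewrite -scalerDl addrC subrK scale1r.
right; case: ax => [[]//|[_ phix fx cx]]; case: ay => [[]//|[_ phiy fy cy]].
split=> //; first exact: phi_convex.
  exact: (@convex_ball _ _ (f a) (eta a)).
move=> b Nb ba; apply: (@convex_ball _ _ (f b) (gam * mdist b a)) => //=.
  exact: cx.
exact: cy.
Qed.

Let N_unique a b c : N b -> N c ->
  mdist b a < del / 2 -> mdist c a < del / 2 -> b = c.
Proof.
move=> Nb Nc ba ca; apply: N_sep => //.
by have := metric_triangle b a c; rewrite (metric_sym a c); lra.
Qed.

(** Under a cone, [phi_cone] gives a point, which the choice of the radius puts within [eta a] of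
    [f a]; away from all cones [f a] itself works. *)
Let psi_nonempty a : psi a !=set0.
Proof.
have [pa|npa] := pselect (pinned a); first by exists (f a); left.
have ea : 0 < eta a.
  by rewrite lt_def eta_ge0 andbT; apply/eqP => ea; apply: npa; left.
have [[b Nb ba]|nb] := pselect (exists2 b, N b & mdist b a <= rho b).
  have [rho0 rhod /(_ a ba) rhoe] := rhoP Nb.
  have nab : a != b by apply/eqP => ab; apply: npa; right; rewrite ab.
  have [z az fz] := phi_cone (f_sel b) nab.
  exists z; right; split=> //.
    by have := ler_distD (f b) (f a) z; rewrite (distrC (f a) (f b)); lra.
  move=> c Nc ca; have [_ rhoc _] := rhoP Nc.
  by have <- : b = c by apply: (N_unique Nb Nc (a := a)); lra.
exists (f a); right; split => //; first by rewrite subrr normr0.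
by move=> b Nb ba; exfalso; apply: nb; exists b.
Qed.

(** The zeros of [eta] form a closed set, and so does [N], having at most one point within [del / 2]
    of [a]. *)
Let near_unpinned a : ~ pinned a -> \forall b \near a, ~ pinned b.
Proof.
move=> npa.
have ea : 0 < eta a.
  by rewrite lt_def eta_ge0 andbT; apply/eqP => ea; apply: npa; left.
have nearN : \forall b \near a, ~ N b.
  have [[c Nc ca]|nc] := pselect (exists2 c, N c & mdist c a < del / 2).
    have ca0 : 0 < mdist c a.
      by rewrite mdist_gt0; apply/eqP => ca'; apply: npa; right; rewrite -ca'.
    near=> b => Nb.
    have : mdist a b < Num.min (del / 2) (mdist c a).
      by near: b; apply: near_mdist_lt; rewrite lt_min ca0 divr_gt0.
    rewrite lt_min metric_sym => /andP[ba].
    by rewrite (N_unique Nb Nc ba ca) ltxx.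
  near=> b => Nb; apply: nc; exists b => //; rewrite metric_sym.
  by near: b; apply: near_mdist_lt; rewrite divr_gt0.
near=> b; case => [eb|]; last by near: b.
have : `|eta a - eta b| < eta a.
  by near: b; move/cvgrPdist_lt : (@eta_cont a); exact.
by rewrite eb subr0 ger0_norm// ltxx.
Unshelve. all: by end_near. Qed.

(** Any point of [psi b] will do: it is within [eta b] of [f b], which is small near a zero of
    [eta], and within [gam * mdist a b] of [f a] near a point [a] of [N]. *)
Let psi_lhc_pinned a (e : R) : pinned a -> 0 < e ->
  \forall b \near a, exists2 z, psi b z & `|f a - z| < e.
Proof.
move=> pa e0; have e2 : 0 < e / 2 by rewrite divr_gt0.
case: pa => [ea|Na].
  near=> b; have [z bz] := psi_nonempty b; exists z => //.
  have fab : `|f a - f b| < e / 2.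
    by near: b; move/cvgrPdist_lt : (@f_cont a); exact.
  have : `|eta a - eta b| < e / 2.
    by near: b; move/cvgrPdist_lt : (@eta_cont a); exact.
  rewrite ea sub0r normrN ger0_norm// => eb.
  by have := psi_eta bz; have := ler_distD (f b) (f a) z; lra.
have [rho0 _ _] := rhoP Na.
near=> b; have [z bz] := psi_nonempty b; exists z => //.
apply: (@le_lt_trans _ _ (gam * mdist a b)).
  apply: psi_cone => //; apply/ltW.
  by near: b; exact: near_mdist_lt.
rewrite mulrC -ltr_pdivlMr//.
by near: b; apply: near_mdist_lt; rewrite divr_gt0.
Unshelve. all: by end_near. Qed.

(* The cones are based at separated points and imposed on closed balls, so near
   [a] no cone is imposed that is not already imposed at [a]. *)
Let psi_lhc : lhc psi.
Proof.
move=> a y e [[pa ->]|[npa phiy fy cy]] e0; first exact: psi_lhc_pinned.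
have lf := lhcI_ball phi_lhc f_cont eta_cont.
have [[c Nc ca]|nc] := pselect (exists2 c, N c & mdist c a < del / 2).
  (* If the cone over [c] is imposed at [a], it is added as a further cut; otherwise [a] is outside
     a closed ball, and so are the nearby points. *)
  have [car|car] := leP (mdist c a) (rho c).
    have dc : continuous (fun b => gam * mdist c b).
      by move=> b; apply: cvgM; [exact: cvg_cst|exact: (lip_continuous (mdist_lip c))].
    have fc : continuous (fun _ : M => f c) by move=> b; exact: cvg_cst.
    have near_z := @lhcI_ball _ _ _ _ _ _ lf fc dc a y e
      (conj (conj phiy fy) (cy c Nc car)) e0.
    near=> b; have [z [[/= bz fbz] fcz] yz] : exists2 z,
        ((phi b `&` [set y | `|f b - y| < eta b]) `&`
          [set y | `|f c - y| < gam * mdist c b]) z & `|y - z| < e.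
      by near: b.
    exists z => //; right; split => //.
      by near: b; exact: near_unpinned.
    move=> c' Nc' c'b; have [_ rhoc' _] := rhoP Nc'.
    suff -> : c' = c by [].
    apply: (N_unique Nc' Nc (a := a)) => //.
    have : mdist b a < del / 4.
      by rewrite metric_sym; near: b; apply: near_mdist_lt; rewrite divr_gt0.
    by have := metric_triangle c' b a; lra.
  near=> b; have [z [/= bz fbz] yz] : exists2 z,
      (phi b `&` [set y | `|f b - y| < eta b]) z & `|y - z| < e.
    by near: b; exact: lf.
  exists z => //; right; split => //; first by near: b; exact: near_unpinned.
  move=> c' Nc' c'b; have [_ rhoc' _] := rhoP Nc'; exfalso.
  have : mdist b a < Num.min (del / 4) (mdist c a - rho c).
    rewrite metric_sym; near: b; apply: near_mdist_lt.
    by rewrite lt_min subr_gt0 car divr_gt0.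
  rewrite lt_min => /andP[ba1 ba2].
  have := metric_triangle c' b a => c'a.
  have c'c : c' = c by apply: (N_unique Nc' Nc (a := a)) => //; lra.
  by rewrite c'c in c'a c'b; lra.
near=> b; have [z [/= bz fbz] yz] : exists2 z,
    (phi b `&` [set y | `|f b - y| < eta b]) z & `|y - z| < e.
  by near: b; exact: lf.
exists z => //; right; split => //; first by near: b; exact: near_unpinned.
move=> c' Nc' c'b; have [_ rhoc' _] := rhoP Nc'; exfalso.
have : mdist b a < del / 4.
  by rewrite metric_sym; near: b; apply: near_mdist_lt; rewrite divr_gt0.
move=> ba; apply: nc; exists c' => //.
by have := metric_triangle c' b a; lra.
Unshelve. all: by end_near. Qed.

(** The selection lies in the closure of [psi], so the bounds become non-strict. At [b] in [N],
    [psi b] is the singleton of [f b], so [g b = f b] is the apex of the cone. *)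
Lemma cone_step : exists g : M -> X,
  [/\ continuous g, forall a, phi a (g a), forall a, `|g a - f a| <= eta a &
   forall b, N b -> exists2 r : R, 0 < r &
     forall a, mdist b a <= r -> `|g b - g a| <= gam * mdist b a].
Proof.
have [g [gc gpsi]] := michael_selection psi_lhc psi_convex psi_nonempty.
exists g; split => //.
- move=> a; apply: closed_approx => // e e0.
  by have [y ay gy] := gpsi a e e0; exists y => //; exact: psi_phi.
- move=> a; apply/ler_addgt0Pr => e e0; have [y ay gy] := gpsi a e e0.
  have := psi_eta ay; have := ler_distD y (g a) (f a).
  by rewrite (distrC y (f a)); lra.
- move=> b Nb; have [rho0 _ _] := rhoP Nb; exists (rho b) => // a ba.
  have -> : g b = f b.
    apply/eqP; rewrite -subr_eq0 -normr_le0; apply/ler_addgt0Pr => e e0.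
    have [y by' gy] := gpsi b e e0; rewrite add0r.
    have <- : y = f b; last exact: ltW.
    by case: by' => [[]//|[np _ _ _]]; exfalso; apply: np; right.
  apply/ler_addgt0Pr => e e0; have [y ay gy] := gpsi a e e0.
  have := psi_cone ay Nb ba; have := ler_distD y (f b) (g a).
  by rewrite (distrC y (g a)); lra.
Qed.

End ConeStep.

(** * Separated sets and the weights bounding the corrections *)

Section Assembly.
Context {R : realType} {M : metricType R}.

Definition separated (del : R) (D : set M) :=
  forall b c, D b -> D c -> mdist b c < del -> b = c.

(** A point at distance at least [del] from a maximal separated set could be added to it. *)
Lemma maximal_separated (del : R) : 0 < del ->
  exists2 D, separated del D & forall x, exists2 b, D b & mdist b x < del.
Proof.
move=> del0; have [|D [sD maxD]] := @Zorn_bigcup M (separated del).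
  move=> F Fsep Ftot b c [A FA Ab] [B FB Bc].
  by have [AB|BA] := Ftot _ _ FA FB;
    [apply: (Fsep _ FB) => //; exact: AB|apply: (Fsep _ FA) => //; exact: BA].
exists D => // x; apply: contrapT => far.
have {}far b : D b -> del <= mdist b x.
  by move=> Db; rewrite leNgt; apply/negP => bx; apply: far; exists b.
apply: (maxD (D `|` [set x])).
  split; first exact: subsetUl.
  move=> /(_ x (or_intror erefl)) Dx.
  by have := far x Dx; rewrite mdistxx leNgt del0.
move=> b c [Db|->] [Dc|->] //; first exact: sD.
  by rewrite ltNge far.
by rewrite metric_sym ltNge far.
Qed.

(** At most one point of [N] lies within [del / 2] of [x], so the distances to [N] are bounded
    below. *)
Lemma tdist_gt0 (del : R) (N : set M) x : 0 < del -> separated del N ->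
  ~ N x -> 0 < tdist N x.
Proof.
move=> del0 sN nNx.
have [[b Nb bx]|nb] := pselect (exists2 b, N b & mdist b x < del / 2).
  have bx0 : 0 < mdist b x.
    by rewrite mdist_gt0; apply/eqP => bx'; apply: nNx; rewrite -bx'.
  apply: (@lt_le_trans _ _ (Num.min 1 (mdist b x))).
    by rewrite lt_min ltr01.
  apply: tdist_ge => [|c Nc]; first by rewrite ge_min lexx.
  rewrite ge_min; apply/orP; right; rewrite leNgt; apply/negP => cx.
  suff cb : c = b by rewrite cb ltxx in cx.
  apply: sN => //; have := metric_triangle c x b.
  by rewrite (metric_sym x b); lra.
apply: (@lt_le_trans _ _ (Num.min 1 (del / 2))).
  by rewrite lt_min ltr01 divr_gt0.
apply: tdist_ge => [|c Nc]; first by rewrite ge_min lexx.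
rewrite ge_min; apply/orP; right; rewrite leNgt; apply/negP => cx.
by apply: nb; exists c.
Qed.

Section Weights.
Variables (D : nat -> set M) (t : R).
Hypothesis D_sep : forall n, separated (2^-1 ^+ n) (D n).
Hypothesis t_gt0 : 0 < t.

(* Bound on the n-th correction: zero exactly at the points of [fresh m], m < n. *)
Fixpoint weight n : M -> R := if n is m.+1 then
  fun a => Num.min (weight m a)
    (t * tdist (D m `&` [set b | 0 < weight m b]) a) / 2
  else fun=> t.

Definition fresh n : set M := D n `&` [set b | 0 < weight n b].

Lemma fresh_sep n : separated (2^-1 ^+ n) (fresh n).
Proof. by move=> b c [Db _] [Dc _]; exact: D_sep. Qed.

Lemma weight_ge0 n a : 0 <= weight n a.
Proof.
elim: n => [|n IH] /=; first exact: ltW.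
by rewrite divr_ge0// le_min IH mulr_ge0 ?tdist_ge0// ltW.
Qed.

Lemma weight_lip n : lip t (weight n).
Proof.
elim: n => [|n IH] x y /=.
  by rewrite lerDl mulr_ge0 ?mdist_ge0// ltW.
set N := _ `&` _.
have T : t * tdist N x <= t * tdist N y + t * mdist x y.
  by rewrite -mulrDr ler_pM2l//; have := tdist_lip N x y; rewrite mul1r.
have W := IH x y.
have d0 : 0 <= t * mdist x y by rewrite mulr_ge0 ?mdist_ge0// ltW.
have : Num.min (weight n x) (t * tdist N x) - t * mdist x y <=
    Num.min (weight n y) (t * tdist N y).
  rewrite le_min; apply/andP; split; rewrite lerBlDr.
    by apply: le_trans W; rewrite ge_min lexx.
  by apply: le_trans T; rewrite ge_min lexx orbT.
lra.
Qed.

Lemma weight_halves n a : weight n.+1 a <= 2^-1 * weight n a.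
Proof. by rewrite mulrC /= ler_pM2r ?invr_gt0// ge_min lexx. Qed.

Lemma weight_decay n k a : weight (n + k) a <= weight n a * 2^-1 ^+ k.
Proof.
elim: k => [|k IH]; first by rewrite addn0 mulr1.
by rewrite addnS exprS; have := weight_halves (n + k) a; lra.
Qed.

(** With later weights halving, the factor 1/2 makes all later corrections add up to at most
    [t * mdist b a]. *)
Lemma weight_fresh n a b : fresh n b -> weight n.+1 a <= t * mdist b a / 2.
Proof.
move=> bn; rewrite /= ler_pM2r ?invr_gt0// ge_min; apply/orP; right.
by rewrite ler_pM2l// tdist_le.
Qed.

Lemma weight_eq0 n a : weight n a = 0 -> exists m, fresh m a.
Proof.
elim: n => [/= t0|n IH wa]; first by move: t_gt0; rewrite t0 ltxx.
have [/IH//|wn0] := eqVneq (weight n a) 0.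
have wn : 0 < weight n a by rewrite lt_def wn0 weight_ge0.
exists n; apply: contrapT => nfa; move: wa => /=; apply/eqP.
rewrite lt0r_neq0// divr_gt0// lt_min wn mulr_gt0//.
by apply: tdist_gt0 (fresh_sep (n := n)) nfa; rewrite exprn_gt0// invr_gt0.
Qed.

(** A point of [D n] close to [x] is either fresh at stage [n] or has weight zero, hence was fresh
    earlier. *)
Lemma fresh_dense :
  (forall n x, exists2 b, D n b & mdist b x < 2^-1 ^+ n) ->
  dense (\bigcup_n fresh n).
Proof.
move=> D_net O [x Ox] oO.
have /near_mdistP[r r0 rO] : \forall y \near x, O y by exact: open_nbhs_nbhs.
have [n] := half_expr_lt 1 r0; rewrite mul1r => nr.
have [b Db bx] := D_net n x.
exists b; split; first by apply: rO; rewrite metric_sym (lt_trans bx).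
have [/weight_eq0[m bm]|wn0] := eqVneq (weight n b) 0; first by exists m.
by exists n => //; split => //=; rewrite lt_def wn0 weight_ge0.
Qed.

End Weights.
End Assembly.

Lemma pointwise_lipschitz_at_near {R : realType} {M : metricType R}
    {X : normedModType R} (beta : R) (f : M -> X) (b : M) (rho : R) :
  0 < rho -> 0 <= beta ->
  (forall a, mdist b a <= rho -> `|f b - f a| <= beta * mdist b a) ->
  pointwise_lipschitz_at beta f b.
Proof.
move=> rho0 beta0 fb.
rewrite /pointwise_lipschitz_at /limf_esup; set G := (G in [set ereal_sup (G @` _) | _ in _]).
(* The limsup is an infimum over neighbourhoods of 0 on the right; the interval from 0 to [rho]
   already gives the bound. *)
apply: (@le_trans _ _ (ereal_sup (G @` [set r : R | 0 < r /\ r < rho]))).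
  apply: ereal_inf_lbound; exists [set r : R | 0 < r /\ r < rho] => //.
  by apply/nbhs_ballP; exists rho => //= r; rewrite /ball/= sub0r normrN => rr r0;
    split => //; exact: le_lt_trans (ler_norm r) rr.
apply: ge_ereal_sup => _ [r [r0 rrho] <-]; rewrite /G.
rewrite lee_pdivrMl// -EFinM; apply: ge_ereal_sup => _ [a /= ar <-].
rewrite lee_fin mulrC; rewrite metric_sym in ar.
apply: le_trans (fb a _) _; first exact: le_trans ar (ltW rrho).
by rewrite ler_wpM2l.
Qed.

(** * Iteration of the corrections from a bounded selection *)

Section DenseSelection.
Context {R : realType} {M : metricType R} {X : completeNormedModType R}.
Variable phi : M -> set X.
Hypothesis phi_lhc : lhc phi.
Hypothesis phi_convex : forall a, convex (phi a).
Hypothesis phi_closed : forall a, closed (phi a).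
Variable gam : R.
Hypothesis gam_gt0 : 0 < gam.
Hypothesis phi_cone : forall (b : M) y, phi b y -> forall a, a != b ->
  exists2 z, phi a z & `|y - z| < gam * mdist b a.

Lemma bounded_selection (x0 : M) (K : R) : (forall x y : M, mdist x y <= K) ->
  phi x0 !=set0 ->
  exists f : M -> X, [/\ continuous f, forall a, phi a (f a) &
    exists B, forall a, `|f a| <= B].
Proof.
move=> MK [y0 y0P].
have K0 : 0 <= K by apply: le_trans (MK x0 x0); exact: mdist_ge0.
(* The cone over [x0] with apex [y0] stays within [gam * K] of [y0], so [phi] meets this ball
   everywhere; the 1 keeps the radius positive when [K = 0]. *)
pose r := gam * (K + 1).
have r0 : 0 < r by rewrite mulr_gt0// ltr_wpDl.
have [|||f [fc fphi]] := @michael_selection _ _ _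
    (fun a => phi a `&` [set y | `|y0 - y| < r]).
- by apply: lhcI_ball => // a; exact: cvg_cst.
- by move=> a; apply: convexI => //; exact: convex_ball.
- move=> a; have [->|ax0] := eqVneq a x0.
    by exists y0; split => //=; rewrite subrr normr0.
  have [z az yz] := phi_cone y0P ax0; exists z; split=> //=.
  apply: lt_le_trans yz _; rewrite ler_pM2l//.
  by rewrite (le_trans (MK _ _))// lerDl.
exists f; split=> //.
- move=> a; apply: closed_approx => // e e0.
  by have [y [] ? _ ?] := fphi a e e0; exists y.
- exists (`|y0| + r + 1) => a.
  have [y [_ /= yr] fy] := fphi a 1 ltr01.
  have := ler_distD y (f a) 0; have := ler_distD y0 y 0.
  by rewrite !subr0 (distrC y y0); lra.
Qed.

Lemma dense_pointwise_selection (f0 : M -> X) (t : R) :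
  continuous f0 -> (forall a, phi a (f0 a)) -> 0 < t ->
  exists f : M -> X,
    [/\ continuous f, forall a, phi a (f a), forall a, `|f a - f0 a| <= 2 * t &
    exists2 D : set M, dense D & forall b, D b -> exists2 rho : R, 0 < rho &
      forall a, mdist b a <= rho -> `|f b - f a| <= (gam + t) * mdist b a].
Proof.
move=> f0c f0s t0.
have q0 n : 0 < 2^-1 ^+ n :> R by rewrite exprn_gt0// invr_gt0.
have /choice[D DP] : forall n, exists D : set M, separated (2^-1 ^+ n) D /\
    forall x, exists2 b, D b & mdist b x < 2^-1 ^+ n.
  by move=> n; have [D ? ?] := @maximal_separated R M _ (q0 n); exists D.
have Dsep n := (DP n).1.
pose eta := weight D t; pose N := fresh D t.
pose good (n : nat) (f : M -> X) := continuous f /\ forall a, phi a (f a).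
pose rel n (f g : M -> X) := (forall a, `|g a - f a| <= eta n a) /\
   forall b, N n b -> exists2 r : R, 0 < r &
     forall a, mdist b a <= r -> `|g b - g a| <= gam * mdist b a.
(* The clause on [n = 0] records that the sequence starts at [f0]. *)
have [||F FP] := @dependent_sequence _ (fun n f => good n f /\ (n = 0%N -> f = f0)) rel.
- by exists f0.
- move=> n f [[fc fs] _].
  have [g [gc gs gf gN]] := @cone_step R M X phi phi_lhc phi_convex phi_closed
    gam gam_gt0 phi_cone f (eta n) (N n) (2^-1 ^+ n) fc fs
    (lip_continuous (weight_lip D t0 n)) (weight_ge0 D t0 n)
    (q0 n) (fresh_sep Dsep (n := n)) (fun b => @proj2 _ _).
  by exists g.
have F0 : F 0%N = f0 by have [[_ ->]] := FP 0%N.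
have Fc n : continuous (F n) by have [[[]]] := FP n.
have Fs n a : phi a (F n a) by have [[[_ ]]] := FP n.
have Feta n a : `|F n.+1 a - F n a| <= eta n a by have [_ []] := FP n.
have FN n b : N n b -> exists2 r : R, 0 < r &
    forall a, mdist b a <= r -> `|F n.+1 b - F n.+1 a| <= gam * mdist b a.
  by have [_ [_]] := FP n; exact.
have eta_t n a : eta n a <= t * 2^-1 ^+ n by exact: weight_decay D t 0%N n a.
have /choice[f fF] : forall a, exists l, forall n,
    `|l - F n a| <= 2 * t * 2^-1 ^+ n.
  move=> a; apply: (geometric_cauchy_lim (u := F^~ a)) => n.
  exact: le_trans (Feta n a) (eta_t n a).
have fFN n b a : N n b -> `|f a - F n.+1 a| <= t * mdist b a.
  (* The sequence from stage [n.+1] on has a limit [l] with the sharper bound; the rest shows that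
     [f a] is as close to [l] as desired. *)
  move=> Nb; have [|l lim_l] := @geometric_cauchy_lim _ _ (fun k => F (n.+1 + k)%N a)
      (t * mdist b a / 2).
    move=> k; rewrite addnS; apply: le_trans (Feta _ a) _.
    apply: le_trans (weight_decay D t n.+1 k a) _.
    by rewrite ler_pM2r//; exact: weight_fresh.
  have lP k : `|l - F (n.+1 + k)%N a| <= t * mdist b a * 2^-1 ^+ k.
    by apply: le_trans (lim_l k) _; lra.
  apply/ler_addgt0Pr => e e0; have [k ke] := half_expr_lt (2 * t + t * mdist b a) e0.
  have := fF a (n.+1 + k)%N; have := lP k; have := lP 0%N.
  rewrite addn0 expr0 mulr1.
  have := ler_distD l (f a) (F n.+1 a).
  have := ler_distD (F (n.+1 + k)%N a) (f a) l.
  rewrite (distrC (F (n.+1 + k)%N a) l).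
  have : 2 * t * 2^-1 ^+ (n.+1 + k) <= 2 * t * 2^-1 ^+ k.
    rewrite ler_pM2l ?mulr_gt0// ler_wiXn2l ?leq_addl//; lra.
  lra.
exists f; split.
- exact: geometric_lim_continuous Fc (fun n a => fF a n).
- move=> a; apply: closed_approx => // e e0.
  have [n ne] := half_expr_lt (2 * t) e0; exists (F n a) => //.
  exact: le_lt_trans (fF a n) ne.
- by move=> a; rewrite -F0; have := fF a 0%N; rewrite expr0 mulr1.
exists (\bigcup_n N n); first by apply: fresh_dense => // n; exact: (DP n).2.
move=> b [n _ Nb]; have [r r0 rP] := FN n b Nb; exists r => // a bar.
have := rP a bar; have := fFN n b a Nb.
(* For [a = b] the bound is 0: [b] is never moved again. The slope is [gam] from [F n.+1] plus [t]
   from the later corrections at [a]. *)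
have := fFN n b b Nb; rewrite mdistxx mulr0 normr_le0 subr_eq0 => /eqP ->.
have := ler_distD (F n.+1 a) (F n.+1 b) (f a).
by rewrite (distrC (F n.+1 a) (f a)); lra.
Qed.

End DenseSelection.

Theorem corollary4p6 (R : realType) (M : metricType R)
    (X : completeNormedModType R) (alpha : R) (phi : M -> set X)
    (M_bounded : bounded_metric M)
    (alpha_ge0 : 0 <= alpha)
    (phi_nonempty : nonempty_valued phi)
    (phi_closed : closed_valued phi)
    (phi_convex : convex_valued phi)
    (phi_lhc : lower_hemicontinuous phi)
    (phi_lip : forall eps : R, 0 < eps ->
      lower_pointwise_lipschitz (alpha + eps) phi) :
  forall beta : R, alpha < beta ->
    exists f : M -> X,
      [/\ selection phi f, bounded_fun f, continuous f &
          exists D : set M, dense D /\ pointwise_lipschitz_on beta f D].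
Proof.
move=> beta ab.
(* The bounded selection needs a base point; on an empty space any function works. *)
have [[x0 _]|Mempty] := pselect ([set: M] !=set0); last first.
  exists (fun=> 0); split.
  - by move=> a; case: Mempty; exists a.
  - by exists 0; split => // K _ a; case: Mempty; exists a.
  - by move=> a; case: Mempty; exists a.
  - exists setT; split; last by move=> b; case: Mempty; exists b.
    by move=> O [a _]; case: Mempty; exists a.
have [K MK] := M_bounded.
(* One third of the gap is the [eps] of the hypothesis, one makes the cones strict, and one pays for
   the later corrections. *)
pose t := (beta - alpha) / 3.
have t0 : 0 < t by rewrite divr_gt0// subr_gt0.
have bE : beta = alpha + 2 * t + t by rewrite /t; field.
have gam0 : 0 < alpha + 2 * t by rewrite ltr_wpDl// mulr_gt0.
have phi_lhc' : lhc phi.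
  move=> a y e ay e0.
  have oB : open (ball y e) by exact: ball_open.
  have [|V [oV Va VU]] := phi_lhc a (ball y e) oB.
    by exists y; split => //; exact: ballxx.
  have : \forall b \near a, V b by exact: open_nbhs_nbhs.
  apply: filterS => b /VU[z [bz]]; rewrite -ball_normE /= => yz.
  by exists z.
have phi_convex' a : convex (phi a).
  move=> x y s ax ay s0 s1.
  have := phi_convex a x y (Itv01 s0 s1); rewrite !inE; exact.
have phi_cone (b : M) y : phi b y -> forall a, a != b ->
    exists2 z, phi a z & `|y - z| < (alpha + 2 * t) * mdist b a.
  move=> by' a; rewrite eq_sym -mdist_gt0 => d0.
  have [z [az [u /= u1 uz]]] := phi_lip t t0 b y by' a.
  exists z => //; rewrite -uz opprD addrA subrr sub0r normrN normrZ.
  have atd : 0 <= (alpha + t) * mdist b a by rewrite mulr_ge0 ?mdist_ge0// addr_ge0// ltW.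
  rewrite (ger0_norm atd); apply: (@le_lt_trans _ _ ((alpha + t) * mdist b a)).
    by rewrite ler_piMr.
  by rewrite ltr_pM2r//; lra.
have [f0 [f0c f0s [B f0B]]] := bounded_selection phi_lhc' phi_convex' phi_closed gam0 phi_cone MK (phi_nonempty x0).
have [f [fc fs ff0 [D denseD fD]]] := dense_pointwise_selection phi_lhc'
  phi_convex' phi_closed gam0 phi_cone f0c f0s t0.
exists f; split => //.
- exists (B + 2 * t); split; first exact: num_real.
  move=> C BC a _ /=; have := ler_distD (f0 a) (f a) 0.
  by rewrite !subr0; have := f0B a; have := ff0 a; lra.
- exists D; split => // b Db; have [rho rho0 rhoP] := fD b Db.
  apply: (pointwise_lipschitz_at_near rho0); last by rewrite bE.
  exact: le_trans alpha_ge0 (ltW ab).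
Qed.
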